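(* Let $a\ne0$ be a real number and let $F=\{f_1<\cdots<f_k\}$ be a finite set of positive integers. If $u$ is a nonnegative integer and $v\in\sigma_F$, then $$q_u^F(v)=\xi_u\,\zeta_v\,c_v^{a;F}(u),$$ where $$\xi_u=\frac{(-a)^{(k+1)u}}{\prod_{i=0}^k(u+i)!},\qquad \zeta_v=\frac{(-a)^{-v}(v-u_F)!\prod_{f\in F}f!}{\prod_{f\in F}(v-f-u_F)}.$$
   Context: Charlier polynomials ($a\ne0$): $c_n^a(x)=\frac1{n!}\sum_{j=0}^n(-a)^{n-j}\binom nj\binom xj j!$, $n\ge0$. Put $u_F=\sum_{f\in F}f-\binom{k+1}{2}$ and $\sigma_F=\{u_F,u_F+1,u_F+2,\dots\}\setminus\{u_F+f: f\in F\}$. For $n\in\sigma_F$, $c_n^{a;F}(x)$ is the $(k+1)\times(k+1)$ determinant whose first row is $(c^a_{n-u_F}(x+j))_{j=0}^{k}$ and whose $(i+1)$-th row is $(c^a_{f_i}(x+j))_{j=0}^k$, $i=1,\dots,k$. For $n\ge0$, $q_n^F(x)$ is the polynomial obtained by dividing by $\prod_{f\in F}(x-f-u_F)$ the $(k+1)\times(k+1)$ determinant whose first row is $(c^a_{n+j}(x-u_F))_{j=0}^k$ and whose $(i+1)$-th row is $(c^a_{n+j}(f_i))_{j=0}^k$, $i=1,\dots,k$. *)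

(* Defs.v *)
From HB Require Import structures.
From mathcomp Require Import all_boot all_order all_algebra.
From mathcomp Require Import finmap reals.

Set Implicit Arguments.
Unset Strict Implicit.
Unset Printing Implicit Defensive.

Import Order.TTheory GRing.Theory Num.Theory.
Local Open Scope fset_scope.
Local Open Scope ring_scope.

(* [fnth F i] is the element f_(i+1) of F = {f_1 < ... < f_k}
   (0-based indexing). *)
Definition fnth (F : {fset nat}) (i : nat) : nat := nth 0%N (sort leq F) i.

(* The subtraction is truncated; see [bin2_le_sum_fset] below: it is exact as
   soon as all the elements of F are positive. *)
Definition uF (F : {fset nat}) : nat :=
  (\sum_(f <- F) f - 'C(#|` F|.+1, 2))%N.

Definition sigmaF (F : {fset nat}) : pred nat :=
  [pred n | (uF F <= n)%N & n \notin [fset (uF F + f)%N | f in F]].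

Section Polynomials.
Variable R : numFieldType.

(* binomial(x, j) = x (x - 1) ... (x - j + 1) / j! as a polynomial in x *)
Definition binomialp (j : nat) : {poly R} :=
  (j`!%:R)^-1 *: \prod_(i < j) ('X - (i%:R)%:P).

Definition charlier (a : R) (n : nat) : {poly R} :=
  (n`!%:R)^-1 *:
    \sum_(j < n.+1) ((- a) ^+ (n - j) * 'C(n, j)%:R * j`!%:R) *: binomialp j.

Definition charlierF_mx (a : R) (F : {fset nat}) (n : nat) :
    'M[{poly R}]_(#|` F|.+1) :=
  \matrix_(i, j)
    (charlier a (if i : nat is i'.+1 then fnth F i' else (n - uF F)%N)
      \Po ('X + (j%:R)%:P)).

(* c_n^{a;F}; it is meaningful for n in sigma_F only, in which case the
   subtraction n - u_F above is exact. *)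
Definition charlierF (a : R) (F : {fset nat}) (n : nat) : {poly R} :=
  \det (charlierF_mx a F n).

Definition qF_mx (a : R) (F : {fset nat}) (n : nat) :
    'M[{poly R}]_(#|` F|.+1) :=
  \matrix_(i, j)
    (if i : nat is i'.+1 then ((charlier a (n + j)).[(fnth F i')%:R])%:P
     else charlier a (n + j) \Po ('X - ((uF F)%:R)%:P)).

Definition qF_den (F : {fset nat}) : {poly R} :=
  \prod_(f <- F) ('X - (f%:R)%:P - ((uF F)%:R)%:P).

(* The division is exact, see [qFK] below. *)
Definition qF (a : R) (F : {fset nat}) (n : nat) : {poly R} :=
  \det (qF_mx a F n) %/ qF_den F.

Definition xi (a : R) (k u : nat) : R :=
  (- a) ^+ (k.+1 * u) / \prod_(i < k.+1) ((u + i)`!)%:R.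

Definition zeta (a : R) (F : {fset nat}) (v : nat) : R :=
  (- a) ^- v * ((v - uF F)`!)%:R * (\prod_(f <- F) (f`!)%:R)
  / \prod_(f <- F) (v%:R - f%:R - (uF F)%:R).

End Polynomials.

Lemma bin2_le_sum_fset (F : {fset nat}) :
  (forall f, f \in F -> (0 < f)%N) ->
  ('C(#|` F|.+1, 2) <= \sum_(f <- F) f)%N.
Proof.
move=> F_gt0.
have -> : (\sum_(f <- F) f = \sum_(f <- sort leq F) f)%N.
  by apply: perm_big; rewrite perm_sym perm_sort.
rewrite -(size_sort leq); set s := sort leq F.
have sP : sorted ltn s by rewrite ltn_sorted_uniq_leq sort_uniq fset_uniq
  sort_sorted //; apply: leq_total.
have s_gt0 f : f \in s -> (0 < f)%N by rewrite mem_sort; apply: F_gt0.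
rewrite (big_nth 0%N) -bin2_sum big_nat_recl // add0n.
rewrite big_nat [X in (_ <= X)%N]big_nat; apply: leq_sum => i /= lt_is.
elim: i lt_is => [|i IHi] lt_is; first by rewrite s_gt0 // mem_nth.
apply: leq_ltn_trans (IHi (ltnW lt_is)) _.
by apply: (sorted_ltn_nth ltn_trans) => //; rewrite inE ltnW.
Qed.

Lemma qF_den_dvd (R : numFieldType) (a : R) (F : {fset nat}) (n : nat) :
  qF_den R F %| \det (qF_mx a F n).
Proof.
have -> : qF_den R F = \prod_(z <- [seq (f + uF F)%:R | f <- F]) ('X - z%:P).
  rewrite big_map; apply: eq_bigr => f _.
  by rewrite natrD polyCD opprD addrA.
apply: uniq_roots_dvdp.
  apply/allP => _ /mapP[f fF ->]; rewrite /root -horner_evalE -det_map_mx.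
  have lt_f : (index f (sort leq F) < #|` F|)%N.
    by rewrite -(size_sort leq) index_mem mem_sort.
  have fE : fnth F (index f (sort leq F)) = f by rewrite /fnth nth_index ?mem_sort.
  have lt_f1 : ((index f (sort leq F)).+1 < #|` F|.+1)%N by [].
  apply/eqP/(@determinant_alternate _ _ _ ord0 (Ordinal lt_f1)) => // j.
  rewrite !mxE /= !horner_evalE fE hornerC horner_comp !hornerE.
  by rewrite natrD addrK.
rewrite uniq_rootsE map_inj_uniq ?fset_uniq // => f g /eqP.
by rewrite eqr_nat eqn_add2r => /eqP.
Qed.

Lemma qFK (R : numFieldType) (a : R) (F : {fset nat}) (n : nat) :
  qF a F n * qF_den R F = \det (qF_mx a F n).
Proof. exact/divpK/qF_den_dvd. Qed.

(* Main.v *)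
Require Import Defs.
From HB Require Import structures.
From mathcomp Require Import all_boot all_order all_algebra.
From mathcomp Require Import finmap reals.
From mathcomp Require Import ring.

Import Order.TTheory GRing.Theory Num.Theory.
Local Open Scope ring_scope.

(** The Charlier polynomials are self-dual at natural numbers: n! (-a)^(-n) c_n(m)
    is symmetric in n and m.  Applying this duality to every entry of the
    determinant defining [qF] at v turns it into the determinant defining
    [charlierF] at u, up to one factor per row and one factor per column; these
    factors multiply out to the constants in the statement because
    u_F + binomial(k+1, 2) is the sum of the elements of F. *)

Lemma prod_natr_ffact {R : comNzRingType} (m j : nat) :
  \prod_(i < j) (m%:R - i%:R) = (m ^_ j)%:R :> R.
Proof.
elim: j => [|j IHj]; first by rewrite big_ord0.
rewrite big_ord_recr /= IHj ffactnSr natrM.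
(* The factor [m - j] given by [ffactnSr] is truncated; when [m < j] the falling factorial is
   already zero, so the truncation is harmless. *)
case: (leqP j m) => [le_jm|lt_mj]; first by rewrite natrB.
by rewrite ffact_small // !mul0r.
Qed.

Lemma natr_fact_neq0 {R : numDomainType} (n : nat) : (n`!)%:R != 0 :> R.
Proof. by rewrite pnatr_eq0 -lt0n fact_gt0. Qed.

Lemma horner_binomialp_nat {R : numFieldType} (j m : nat) :
  (binomialp R j).[m%:R] = 'C(m, j)%:R.
Proof.
rewrite /binomialp hornerZ horner_prod.
under eq_bigr do rewrite hornerXsubC.
rewrite prod_natr_ffact -bin_ffact natrM mulrC mulfK //.
exact: natr_fact_neq0.
Qed.

(** Terms with [j > n] vanish with ['C(n, j)], so the sum may run up to any [N >= n]. With a bound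
    common to [n] and [m], the sum is visibly symmetric in the two. *)
Lemma horner_charlier_nat {R : numFieldType} (a : R) (n m N : nat) :
  a != 0 -> (n <= N)%N ->
  (charlier a n).[m%:R] = (- a) ^+ n / (n`!)%:R *
    \sum_(j < N.+1) (- a) ^- j * ('C(n, j) * 'C(m, j) * j`!)%:R.
Proof.
move=> a_neq0 le_nN; rewrite /charlier hornerZ horner_sum [_ / _]mulrC -mulrA.
congr (_ * _).
rewrite (big_ord_widen N.+1 (fun j => ((- a) ^+ (n - j) * 'C(n, j)%:R *
  j`!%:R *: binomialp R j).[m%:R])) // big_mkcond mulr_sumr.
apply: eq_bigr => j _; case: ltnP => [lt_jn|lt_nj].
  rewrite hornerZ horner_binomialp_nat !natrM expfB_cond; last first.
    by rewrite oppr_eq0 (negPf a_neq0).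
  ring.
by rewrite bin_small // !mul0n mulr0 mulr0.
Qed.

Lemma charlier_dual {R : numFieldType} (a : R) (n m : nat) : a != 0 ->
  (charlier a n).[m%:R] =
    (- a) ^- m * (m`!)%:R * ((- a) ^+ n / (n`!)%:R) * (charlier a m).[n%:R].
Proof.
move=> a_neq0; have b_neq0 : - a != 0 by rewrite oppr_eq0.
rewrite (@horner_charlier_nat _ a n m (n + m)) ?leq_addr //.
rewrite (@horner_charlier_nat _ a m n (n + m)) ?leq_addl //.
under [X in _ = _ * (_ * X)]eq_bigr do rewrite [('C(m, _) * _)%N]mulnC.
(* Both sides now contain the same sum; naming it and the two powers leaves an identity of fractions
   in atoms. *)
have bm_neq0 : (- a) ^+ m != 0 by rewrite expf_neq0.
set S := \sum_(j < _) _; move: ((- a) ^+ m) bm_neq0 ((- a) ^+ n) => x x_neq0 y.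
by field; rewrite x_neq0 !natr_fact_neq0.
Qed.

Lemma det_scale {R : comNzRingType} (n : nat) (d e : 'I_n -> R) (A : 'M[R]_n) :
  \det (\matrix_(i, j) (d i * e j * A i j)) =
    (\prod_i d i) * (\prod_j e j) * \det A.
Proof.
have -> : \matrix_(i, j) (d i * e j * A i j) =
    diag_mx (\row_i d i) *m (A *m diag_mx (\row_j e j)).
  apply/matrixP => i j; rewrite mul_diag_mx mul_mx_diag !mxE; ring.
rewrite !det_mulmx !det_diag.
under eq_bigr do rewrite mxE.
under [X in _ * (_ * X)]eq_bigr do rewrite mxE.
ring.
Qed.

Lemma prod_fnth {R : comNzRingType} (F : {fset nat}) (g : nat -> R) :
  \prod_(i < #|` F|%fset) g (fnth F i) = \prod_(f <- F) g f.
Proof.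
rewrite -(size_sort leq) -(big_mkord xpredT (fun i => g (fnth F i))).
rewrite -(big_nth 0%N xpredT); apply: perm_big.
by rewrite perm_sort.
Qed.

(** The roots of the denominator are the numbers [f + uF F], exactly those that [sigmaF]
    excludes. *)
Lemma horner_qF_den_neq0 {R : numFieldType} (F : {fset nat}) (v : nat) :
  v \in sigmaF F -> (qF_den R F).[v%:R] != 0.
Proof.
rewrite inE => /andP[_ vNF]; rewrite horner_prod.
rewrite prodf_seq_neq0; apply/allP => f fF; rewrite !hornerE -addrA -opprD subr_eq0 -natrD.
rewrite eqr_nat; apply: contraNneq vNF => ->.
by apply/imfsetP; exists f; rewrite // addnC.
Qed.

Lemma uFK (F : {fset nat}) : (forall f, f \in F -> (0 < f)%N) ->
  (uF F + 'C(#|` F|%fset.+1, 2) = \sum_(f <- F) f)%N.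
Proof. by move=> /bin2_le_sum_fset/subnK. Qed.

Theorem lemma3p2 (R : realType) (a : R) (F : {fset nat}) (u v : nat)
    (ha : a != 0) (hF : forall f : nat, f \in F -> (0 < f)%N)
    (hv : v \in sigmaF F) :
  (qF a F u).[v%:R] = xi a #|` F|%fset u * zeta a F v * (charlierF a F v).[u%:R].
Proof.
set b := - a; have b_neq0 : b != 0 by rewrite oppr_eq0.
have uF_le_v : (uF F <= v)%N by move: hv; rewrite inE => /andP[].
have den_neq0 := @horner_qF_den_neq0 R F v hv.
have denE : \prod_(f <- F) (v%:R - f%:R - (uF F)%:R) = (qF_den R F).[v%:R].
  by rewrite horner_prod; apply: eq_bigr => f _; rewrite !hornerE.
(* Clearing the nonzero denominator replaces the polynomial quotient by the determinant itself. *)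
apply: (mulIf den_neq0); rewrite -hornerM qFK /zeta denE.
(* [m i] is both the evaluation point of row [i] of [qF_mx] at [v] and the degree indexing row [i]
   of [charlierF_mx]. Duality exchanges these roles, with row factor [d i] and column factor
   [e j]. *)
pose m (i : nat) := if i is i'.+1 then fnth F i' else (v - uF F)%N.
pose d i := b ^- m i * ((m i)`!)%:R.
pose e j := b ^+ (u + j) / ((u + j)`!)%:R.
have detE : (\det (qF_mx a F u)).[v%:R] =
    (\prod_(i < #|` F|%fset.+1) d i) * (\prod_(j < #|` F|%fset.+1) e j) *
    (charlierF a F v).[u%:R].
  rewrite /charlierF -!horner_evalE -!det_map_mx -det_scale; congr (\det _).
  apply/matrixP => i j; rewrite !mxE /= !horner_evalE.
  rewrite [in RHS]horner_comp hornerD hornerX hornerC -natrD.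
  rewrite -/(m i) -(charlier_dual a (u + j)%N (m i) ha).
  case: i => -[|i] lti /=; last by rewrite hornerC.
  by rewrite horner_comp hornerXsubC -natrB.
have dE : \prod_(i < #|` F|%fset.+1) d i =
    b ^- (v - uF F) * ((v - uF F)`!)%:R *
    (b ^- (\sum_(f <- F) f) * \prod_(f <- F) (f`!)%:R).
  rewrite big_ord_recl; congr (_ * _).
  rewrite (prod_fnth F (fun f => b ^- f * (f`!)%:R)) big_split /=; congr (_ * _).
  by rewrite prodfV expr_sum.
have eE : \prod_(j < #|` F|%fset.+1) e j =
    b ^+ (#|` F|%fset.+1 * u) * b ^+ 'C(#|` F|%fset.+1, 2) /
    \prod_(j < #|` F|%fset.+1) ((u + j)`!)%:R.
  rewrite prodf_div; congr (_ / _).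
  rewrite -expr_sum big_split /= sum_nat_const card_ord exprD.
  by rewrite -bin2_sum big_mkord.
(* Splitting the sum of [F] as [uF F] plus the binomial, and [v] as [(v - uF F) + uF F], makes the
   powers of [b] on both sides cancel. *)
rewrite detE dE eE /xi -/b -(uFK F hF) exprD -[in b ^- v](subnK uF_le_v) exprD.
have fact_neq0 : \prod_(j < #|` F|%fset.+1) ((u + j)`!)%:R != 0 :> R.
  by apply/prodf_neq0 => j _; apply: natr_fact_neq0.
have bX n : b ^+ n != 0 by rewrite expf_neq0.
by field; rewrite !bX den_neq0 fact_neq0.
Qed.
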